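(* Let $a,b$ be positive integers with $a\le b$ and let $f^{a,b}_3(x,y,z,w)=ax^2+by^2+3(z^2+zw+w^2)$. If $f^{a,b}_3$ represents $1$, $2$ and $6$ (with integer arguments), then it represents every nonnegative integer. *)

(* Defs.v *)
From Stdlib Require Import ZArith.
Open Scope Z_scope.

Definition f3 (a b x y z w : Z) : Z :=
  a * x ^ 2 + b * y ^ 2 + 3 * (z ^ 2 + z * w + w ^ 2).

Definition represents (a b n : Z) : Prop :=
  exists x y z w : Z, f3 a b x y z w = n.

(* Main.v *)
(**
Representing 1, 2 and 6 forces a = 1 and b = 2.  The identity
3 (u^2 + v^2 + w^2) = (u + v + w)^2 + 2 (d^2 + d e + e^2), with d = u - v and
e = v - w, shows that 2 y^2 + 3 (z^2 + z w + w^2) represents m when m = 2 mod 3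
and 6 m is a sum of three squares, and represents 3 k when k <> 2 mod 3 and 2 k is
a sum of three squares.  Subtracting a suitable small square x^2 from n, it is
enough to know that 2 k is a sum of three squares for every odd k > 0.

Put M = 2 k.  If A > 0, -M is a square mod A and -A is a square mod M, then M is
represented by a positive ternary form of determinant 1, which is a sum of three
squares by Hermite reduction.  To find A without Dirichlet's theorem on primes,
let chi be the character with chi(q) = (-M / q), periodic mod m = 8 k by quadratic
reciprocity (proved with Gauss sums), and R(t) the sum of chi over the divisors
of t.  By the hyperbola method the sums of R over t <= N^2 in any two classes
g, h mod m with chi(g) = chi(h) = 1 differ by O(N).  In the class of 1 this sum
exceeds every multiple of N, because of the values u^2 + M y^2; hence some
t = g mod m has R(t) > 0, and such a t is A s^2 with -M a square mod A.  The
class g = -1 mod k, g = 3 mod 8 also makes -A a square mod M.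
*)
Require Import Defs.
From Stdlib Require Import ZArith Lia.
From mathcomp Require Import all_boot all_order all_algebra cyclic all_field.
From mathcomp Require Import zify ring.
Import GRing.Theory.
Open Scope Z_scope.

(** * Reduction of ternary forms *)

Definition sum3sq (n : Z) : Prop := exists u v w : Z, n = u * u + v * v + w * w.

Lemma nearest_multiple (a f : Z) : 0 < a -> exists k, - a <= 2 * (f + k * a) <= a.
Proof.
intros Ha; exists (- ((2 * f + a) / (2 * a))).
pose proof (Z.div_mod (2 * f + a) (2 * a)) as E.
pose proof (Z.mod_pos_bound (2 * f + a) (2 * a)) as B.
nia.
Qed.

(** Gauss reduction: a translation makes [|2 B| <= A], and a swap lowers the leading coefficient
    while [C < A]. Once [A <= C], [D = A C - B^2] is at least [A^2 - A^2 / 4]. *)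
Lemma binary_reduction (A B C D : Z) :
  0 < A -> 0 < D -> A * C - B * B = D ->
  exists p q r s A' B' C' : Z,
    p * s - q * r = 1 /\
    (forall x y, A * (p * x + q * y) ^ 2 + 2 * B * (p * x + q * y) * (r * x + s * y)
      + C * (r * x + s * y) ^ 2 = A' * x ^ 2 + 2 * B' * x * y + C' * y ^ 2) /\
    0 < A' /\ A' * C' - B' * B' = D /\ 3 * (A' * A') <= 4 * D.
Proof.
intros HA HD E.
revert B C HA E.
induction A as [A IH] using (well_founded_induction (Z.lt_wf 0)); intros B C HA E.
destruct (nearest_multiple A B HA) as [k Hk].
set (B1 := B + k * A) in *.
set (C1 := C + 2 * k * B + k * k * A).
assert (E1 : A * C1 - B1 * B1 = D) by (unfold B1, C1; nia).
assert (HC1 : 0 < C1) by nia.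
destruct (Z_lt_le_dec C1 A) as [Hlt | Hle].
- destruct (IH C1 ltac:(lia) (- B1) A HC1 ltac:(nia))
    as (p & q & r & s & A' & B' & C' & Hdet & Hval & HA' & HD' & Hred).
  exists (k * p - r), (k * q - s), p, q, A', B', C'.
  split; [nia|]. split; [|auto].
  intros x y. rewrite <- Hval. unfold B1, C1. ring.
- exists 1, k, 0, 1, A, B1, C1.
  split; [ring|]. split; [|split; [lia|split; [lia|nia]]].
  intros x y. unfold B1, C1. ring.
Qed.

Lemma binary_det1 (A B C : Z) :
  0 < A -> A * C - B * B = 1 ->
  forall x y, exists v w, A * x ^ 2 + 2 * B * x * y + C * y ^ 2 = v * v + w * w.
Proof.
intros HA E x y.
destruct (binary_reduction A B C 1 HA ltac:(lia) E)
  as (p & q & r & s & A' & B' & C' & Hdet & Hval & HA' & HD' & Hred).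
assert (A' = 1) by nia; subst A'.
(* The inverse substitution is applied to [(x, y)]; the reduced form is [(x + B' y)^2 + y^2]. *)
exists ((s * x - q * y) + B' * (- r * x + p * y)), (- r * x + p * y).
pose proof (Hval (s * x - q * y) (- r * x + p * y)) as H.
replace (p * (s * x - q * y) + q * (- r * x + p * y)) with x in H
  by (transitivity ((p * s - q * r) * x); [rewrite Hdet|]; ring).
replace (r * (s * x - q * y) + s * (- r * x + p * y)) with y in H
  by (transitivity ((p * s - q * r) * y); [rewrite Hdet|]; ring).
rewrite H. assert (C' = 1 + B' * B') by lia. subst C'. ring.
Qed.

Definition ternary (a b c d e f x y z : Z) : Z :=
  a * x ^ 2 + b * y ^ 2 + c * z ^ 2 + 2 * d * y * z + 2 * e * x * z + 2 * f * x * y.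

(* Hermite reduction: with [a] least among the leading coefficients reached,
   reducing the binary form of the projection along the first vector gives
   [27 a^3 <= 64], hence [a = 1]. *)
Lemma ternary_det1 (a b c d e f : Z) :
  0 < a -> 0 < a * b - f * f ->
  a * b * c + 2 * d * e * f - a * d * d - b * e * e - c * f * f = 1 ->
  forall x y z, sum3sq (ternary a b c d e f x y z).
Proof.
intros Ha.
revert b c d e f Ha.
induction a as [a IH] using (well_founded_induction (Z.lt_wf 0)).
intros b c d e f Ha Hk Hdet x y z.
(* [a] times the form is [(a x + f y + e z)^2] plus a binary form with these coefficients, whose
   determinant is [a] times the ternary one. *)
assert (E : (a * b - f * f) * (a * c - e * e) - (a * d - e * f) * (a * d - e * f) = a).
{ transitivity (a * (a * b * c + 2 * d * e * f - a * d * d - b * e * e - c * f * f));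
    [ring|rewrite Hdet; ring]. }
destruct (binary_reduction _ _ _ a Hk Ha E)
  as (p & q & r & s & A' & B' & C' & Hdt & Hval & HA' & HD' & Hred).
set (f1 := f * p + e * r). set (e1 := f * q + e * s).
destruct (nearest_multiple a f1 Ha) as [k Hk1].
destruct (nearest_multiple a e1 Ha) as [l Hl1].
set (b1 := b * p ^ 2 + 2 * d * p * r + c * r ^ 2).
set (d1 := b * p * q + d * (p * s + q * r) + c * r * s).
set (c1 := b * q ^ 2 + 2 * d * q * s + c * s ^ 2).
(* Adding multiples of the first basis vector to the other two leaves the projected binary form
   unchanged, as [EA], [EC] and [EB] confirm. *)
set (f2 := f1 + k * a) in *. set (e2 := e1 + l * a) in *.
set (b2 := b1 + 2 * k * f1 + k * k * a).
set (c2 := c1 + 2 * l * e1 + l * l * a).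
set (d2 := d1 + k * e1 + l * f1 + k * l * a).
assert (EA : a * b2 - f2 * f2 = A').
{ pose proof (Hval 1 0) as H. transitivity (A' * 1 ^ 2 + 2 * B' * 1 * 0 + C' * 0 ^ 2); [|ring].
  rewrite <- H. unfold b2, f2, b1, f1. ring. }
assert (EC : a * c2 - e2 * e2 = C').
{ pose proof (Hval 0 1) as H. transitivity (A' * 0 ^ 2 + 2 * B' * 0 * 1 + C' * 1 ^ 2); [|ring].
  rewrite <- H. unfold c2, e2, c1, e1. ring. }
assert (EB : a * d2 - e2 * f2 = B').
{ pose proof (Hval 1 1) as H.
  assert (A' + 2 * (a * d2 - e2 * f2) + C' = A' * 1 ^ 2 + 2 * B' * 1 * 1 + C' * 1 ^ 2); [|lia].
  rewrite <- H, <- EA, <- EC. unfold b2, c2, d2, e2, f2, b1, c1, d1, e1, f1. ring. }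
assert (Hdet2 : a * b2 * c2 + 2 * d2 * e2 * f2 - a * d2 * d2 - b2 * e2 * e2 - c2 * f2 * f2 = 1).
{ apply (Z.mul_reg_l _ _ a); [lia|].
  transitivity (A' * C' - B' * B'); [rewrite <- EA, <- EB, <- EC; ring | lia]. }
assert (Hval2 : exists x' y' z',
  ternary a b c d e f x y z = ternary a b2 c2 d2 e2 f2 x' y' z').
{ exists (x - k * (s * y - q * z) - l * (- r * y + p * z)), (s * y - q * z), (- r * y + p * z).
  set (y' := s * y - q * z). set (z' := - r * y + p * z).
  assert (Ey : y = p * y' + q * z') by
    (transitivity ((p * s - q * r) * y); [rewrite Hdt|unfold y', z']; ring).
  assert (Ez : z = r * y' + s * z') by
    (transitivity ((p * s - q * r) * z); [rewrite Hdt|unfold y', z']; ring).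
  clearbody y' z'. subst y z. unfold ternary, b2, c2, d2, e2, f2, b1, c1, d1, e1, f1. ring. }
destruct Hval2 as (x' & y' & z' & ->).
clear Hval E Hdet Hk x y z.
clearbody b2 c2 d2 e2 f2. clear b1 c1 d1 e1 f1 b c d e f Hdt p q r s k l.
assert (Hb2 : 0 < b2).
{ apply (Z.mul_pos_cancel_l a); [lia|]. pose proof (Z.square_nonneg f2). lia. }
destruct (Z_lt_le_dec b2 a) as [Hlt | Hle].
- replace (ternary a b2 c2 d2 e2 f2 x' y' z') with (ternary b2 a c2 e2 d2 f2 y' x' z')
    by (unfold ternary; ring).
  apply IH; lia.
- assert (H1 : 3 * (a * a) <= 4 * A').
  { clear - EA Hle Hk1 Ha. nia. }
  assert (Ha1 : a = 1).
  { clear - H1 Hred Ha HA'. assert (9 * ((a * a) * (a * a)) <= 16 * (A' * A')) by nia.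
    assert (27 * (a * a * a) <= 64) by nia. nia. }
  rewrite Ha1 in HD' EA EB EC *.
  destruct (binary_det1 A' B' C' HA' HD' y' z') as (v & w & Hvw).
  exists (x' + f2 * y' + e2 * z'), v, w.
  rewrite <- Z.add_assoc, <- Hvw, <- EA, <- EB, <- EC. unfold ternary. ring.
Qed.

(* The ternary form with Gram matrix [[g, h, r], [h, j, s], [r, s, M]] has
   determinant 1 and represents [M]; [A x^2 + 2 B x y + C y^2] is [M] times its
   projection along the third vector. *)
Lemma sum3sq_of_binary (M A B C g h j r s : Z) :
  0 < M -> 0 < A -> A * C - B * B = M ->
  A + r * r = M * g -> B + r * s = M * h -> C + s * s = M * j -> sum3sq M.
Proof.
intros HM HA E Hg Hh Hj.
assert (Hdet : g * j * M + 2 * s * r * h - g * s * s - j * r * r - M * h * h = 1).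
{ apply (Z.mul_reg_l _ _ M); [lia|].
  transitivity ((M * g) * (M * j) - (M * h) * (M * h) - (M * g) * s * s
    - (M * j) * r * r + 2 * r * s * (M * h)); [ring|].
  rewrite <- Hg, <- Hh, <- Hj, <- E. ring. }
assert (Hdet2 : M * g * j + 2 * h * s * r - M * h * h - g * s * s - j * r * r = 1) by lia.
assert (Hk : 0 < M * g - r * r) by lia.
destruct (ternary_det1 M g j h s r HM Hk Hdet2 1 0 0) as (u & v & w & Huvw).
exists u, v, w. rewrite <- Huvw. unfold ternary. ring.
Qed.

(** * From three squares to the quaternary form *)

Lemma square_root_mod3 (u : Z) :
  exists t, u * u = (3 * t) * (3 * t) \/ u * u = (3 * t + 1) * (3 * t + 1).
Proof.
pose proof (Z.div_mod u 3 ltac:(lia)) as E.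
pose proof (Z.mod_pos_bound u 3 ltac:(lia)) as B.
assert (u mod 3 = 0 \/ u mod 3 = 1 \/ u mod 3 = 2) as [H | [H | H]] by lia; rewrite H in E.
- exists (u / 3). left. rewrite {1 2}E. ring.
- exists (u / 3). right. rewrite {1 2}E. ring.
- exists (- (u / 3) - 1). right. rewrite {1 2}E. ring.
Qed.

Lemma half_of_even_sum (k s u v w : Z) :
  2 * k = u * u + v * v + w * w -> u + v + w = 3 * s -> exists t, s = 2 * t.
Proof.
intros E Es; apply Z.even_spec.
apply (f_equal Z.even) in E; apply (f_equal Z.even) in Es.
rewrite !Z.even_add !Z.even_mul in E Es.
revert E Es; simpl.
destruct (Z.even u), (Z.even v), (Z.even w), (Z.even s); simpl; congruence.
Qed.

Definition rep23 (m : Z) : Prop :=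
  exists y z w, m = 2 * y ^ 2 + 3 * (z ^ 2 + z * w + w ^ 2).

Lemma rep23_of_sum3sq_sum0 (k s u v w : Z) :
  2 * k = u * u + v * v + w * w -> u + v + w = 3 * s -> rep23 (3 * k).
Proof.
intros E Es; destruct (half_of_even_sum _ _ _ _ _ E Es) as [t ->].
(* With [d = u - v] and [e = v - w], the last two witnesses are [(d + 2 e) / 3] and [(d - e) / 3]:
   dividing by an Eisenstein integer of norm 3. *)
exists (3 * t), (2 * t - w), (2 * t - v).
assert (u = 6 * t - v - w) by lia; subst u.
apply (Z.mul_reg_l _ _ 2); [lia|].
replace (2 * (3 * k)) with (3 * (2 * k)) by ring; rewrite E; ring.
Qed.

(** Since [2 k] is not 1 mod 3, the number of [u], [v], [w] prime to 3 is not one, so signs can be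
    chosen that make their sum divisible by 3. *)
Lemma rep23_of_sum3sq (k : Z) : k mod 3 <> 2 -> sum3sq (2 * k) -> rep23 (3 * k).
Proof.
intros Hk (u & v & w & E).
pose proof (Z.div_mod k 3 ltac:(lia)) as Ek.
pose proof (Z.mod_pos_bound k 3 ltac:(lia)) as Bk.
destruct (square_root_mod3 u) as [a [Hu | Hu]];
  destruct (square_root_mod3 v) as [b [Hv | Hv]];
  destruct (square_root_mod3 w) as [c [Hw | Hw]]; rewrite Hu Hv Hw in E;
  [ apply (rep23_of_sum3sq_sum0 k (a + b + c) (3 * a) (3 * b) (3 * c)); lia
  | exfalso; lia | exfalso; lia
  | apply (rep23_of_sum3sq_sum0 k (a + b - c) (3 * a) (3 * b + 1) (- (3 * c + 1))); lia
  | exfalso; lia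
  | apply (rep23_of_sum3sq_sum0 k (a + b - c) (3 * a + 1) (3 * b) (- (3 * c + 1))); lia
  | apply (rep23_of_sum3sq_sum0 k (a - b + c) (3 * a + 1) (- (3 * b + 1)) (3 * c)); lia
  | apply (rep23_of_sum3sq_sum0 k (a + b + c + 1) (3 * a + 1) (3 * b + 1) (3 * c + 1)); lia ].
Qed.

Lemma rep23_of_sum3sq_6 (m : Z) : m mod 3 = 2 -> sum3sq (6 * m) -> rep23 m.
Proof.
intros Hm (u & v & w & E).
pose proof (Z.div_mod m 3 ltac:(lia)) as Em; rewrite Hm in Em.
destruct (square_root_mod3 u) as [a [Hu | Hu]];
  destruct (square_root_mod3 v) as [b [Hv | Hv]];
  destruct (square_root_mod3 w) as [c [Hw | Hw]]; rewrite Hu Hv Hw in E;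
  try (exfalso; lia).
(* All three roots are now 1 mod 3 up to sign. As [6 m = 3] mod 9, the sum [a + b + c] is divisible
   by 3. *)
assert (exists g, b - a + (c - a) = 3 * g) as [g Hg].
{ exists (a * a + b * b + c * c + b + c - 2 * (m / 3) - 1); lia. }
assert (c = 3 * g - b + 2 * a) by lia; subst c.
assert (Es : 3 * a + 1 + (3 * b + 1) + (3 * (3 * g - b + 2 * a) + 1) = 3 * (3 * a + 1 + 3 * g))
  by ring.
replace (6 * m) with (2 * (3 * m)) in E by ring.
destruct (half_of_even_sum _ _ _ _ _ E Es) as [t Ht].
(* The last two witnesses are [(2 b - a - c) / 3] and [(2 a - b - c) / 3], again a division by an
   element of norm 3, now of the differences [a - b] and [b - c]. *)
exists t, (b - a - g), (- g).
apply (Z.mul_reg_l _ _ 6); [lia|].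
replace (6 * (2 * t ^ 2 + 3 * ((b - a - g) ^ 2 + (b - a - g) * - g + (- g) ^ 2)))
  with (3 * (2 * t) ^ 2 + 18 * ((b - a - g) ^ 2 + (b - a - g) * - g + (- g) ^ 2)) by ring.
rewrite <- Ht; transitivity (2 * (3 * m)); [ring|rewrite E; ring].
Qed.

Definition f123 (n : Z) : Prop := exists x, rep23 (n - x ^ 2).

(** The square [x ^ 2] is chosen so that [n - x ^ 2] is odd and either 2 mod 3, or [3 k] with
    [k <> 2] mod 3. In the second case the choice depends on [n] mod 9. *)
Lemma f123_universal :
  (forall k, 0 < k -> Z.odd k = true -> sum3sq (2 * k)) ->
  forall n, 0 <= n -> f123 n.
Proof.
intros H n Hn.
assert (G : forall x k, n - x ^ 2 = 3 * k -> 0 < k -> k mod 3 <> 2 -> k mod 2 = 1 -> f123 n).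
{ intros x k E Hk Hk3 Hk2; exists x; rewrite E; apply rep23_of_sum3sq; [exact Hk3|].
  apply H; [exact Hk|rewrite Zodd_mod Hk2; reflexivity]. }
assert (G6 : forall x m, n - x ^ 2 = m -> 0 < m -> m mod 3 = 2 -> m mod 2 = 1 -> f123 n).
{ intros x m E Hk Hk3 Hk2; exists x; rewrite E; apply rep23_of_sum3sq_6; [exact Hk3|].
  replace (6 * m) with (2 * (3 * m)) by ring.
  apply H; [lia|rewrite Z.odd_mul (Zodd_mod m) Hk2; reflexivity]. }
assert (S : forall x y z w, n = x ^ 2 + 2 * y ^ 2 + 3 * (z ^ 2 + z * w + w ^ 2) -> f123 n).
{ intros x y z w E; exists x, y, z, w; lia. }
assert (n mod 3 = 0 \/ n mod 3 = 2 \/ n mod 9 = 1 \/ n mod 9 = 4 \/ n mod 9 = 7)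
  as Hmod by (Z.div_mod_to_equations; lia).
assert (n mod 2 = 0 \/ n mod 2 = 1) as Hpar by (Z.div_mod_to_equations; lia).
destruct Hmod as [H0 | [H2 | H9]]; [destruct Hpar | destruct Hpar | ].
- destruct (Z.eq_dec n 0); [apply (S 0 0 0 0); lia|].
  apply (G6 1 (n - 1)); Z.div_mod_to_equations; lia.
- destruct (Z.eq_dec n 3); [apply (S 0 0 1 0); lia|].
  apply (G6 2 (n - 4)); Z.div_mod_to_equations; lia.
- destruct (Z.eq_dec n 2); [apply (S 0 1 0 0); lia|].
  destruct (Z.eq_dec n 8); [apply (S 0 2 0 0); lia|].
  apply (G6 3 (n - 9)); Z.div_mod_to_equations; lia.
- apply (G6 0 n); Z.div_mod_to_equations; lia.
(* Below, [x] goes up to 5, so positivity of [k] is ensured only for [n > 25]. *)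
- destruct (Z_lt_le_dec n 26) as [Hlt | Hge].
  { assert (n = 1 \/ n = 4 \/ n = 7 \/ n = 10 \/ n = 13 \/ n = 16 \/ n = 19 \/ n = 22 \/ n = 25)
      as Hs by (Z.div_mod_to_equations; lia).
    repeat destruct Hs as [Hs | Hs]; rewrite Hs in S |- *;
      [apply (S 1 0 0 0) | apply (S 2 0 0 0) | apply (S 2 0 1 0) | apply (S 1 0 1 1)
      |apply (S 2 0 1 1) | apply (S 4 0 0 0) | apply (S 4 0 1 0) | apply (S 2 3 0 0)
      |apply (S 5 0 0 0)]; reflexivity. }
  destruct Hpar as [He | Ho]; destruct H9 as [H9 | [H9 | H9]];
  [ apply (G 1 ((n - 1) / 3)) | apply (G 1 ((n - 1) / 3)) | apply (G 5 ((n - 25) / 3))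
  | apply (G 4 ((n - 16) / 3)) | apply (G 2 ((n - 4) / 3)) | apply (G 2 ((n - 4) / 3)) ];
  Z.div_mod_to_equations; lia.
Qed.

Set Implicit Arguments.
Unset Strict Implicit.
Unset Printing Implicit Defensive.
Local Open Scope nat_scope.

(** * Quadratic reciprocity *)

Section FiniteFields.
Local Open Scope ring_scope.

Lemma finField_prim_root (F : finFieldType) (n : nat) :
  (0 < n)%N -> (n %| #|F|.-1)%N -> exists z : F, n.-primitive_root z.
Proof.
move=> n_gt0 dvn; have N_gt0 : (0 < #|F|.-1)%N by rewrite -ltnS prednK ?finNzRing_gt1 // (cardD1 0).
have /hasP[w _ prim_w] : has #|F|.-1.-primitive_root (rem (0 : F) (enum F)).
  apply: has_prim_root => //; last by rewrite size_rem ?mem_enum // -cardE.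
    apply/allP => x; rewrite mem_rem_uniq ?enum_uniq // !inE => /andP[x0 _].
    by rewrite unity_rootE -subr_eq0 -(mulrI_eq0 _ (mulfI x0)) mulrBr mulr1 -exprS
      prednK ?expf_card ?subrr // (cardD1 0).
  by rewrite rem_uniq ?enum_uniq.
exists (w ^+ (#|F|.-1 %/ n)); apply: (dvdn_prim_root prim_w dvn).
Qed.

Definition is_sq (F : finFieldType) (x : F) := [exists y : F, y ^+ 2 == x].

(** For a generator [w] and [x = w ^ i], both sides are [(-1) ^ i]: [w ^ h = -1], and the parity of
    [i] is well defined because the group order [2 h] is even. *)
Lemma Euler_criterion (F : finFieldType) (h : nat) (x : F) :
  #|F| = h.*2.+1 -> x != 0 -> x ^+ h = (-1) ^+ (~~ is_sq x).
Proof.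
move=> cF x0.
have h_gt0 : (0 < h)%N by have := finNzRing_gt1 F; rewrite cF; case: (h).
have [w prim_w] : exists w : F, h.*2.-primitive_root w.
  by apply: finField_prim_root; rewrite ?double_gt0 // cF.
have xN : x ^+ h.*2 = 1.
  by apply: (mulfI x0); rewrite -exprS -cF expf_card mulr1.
have [i wi] := prim_rootP prim_w xN; rewrite wi.
have wh : w ^+ h = -1.
  have : w ^+ h ^+ 2 = 1 by rewrite -exprM muln2 (prim_expr_order prim_w).
  move/eqP; rewrite sqrf_eq1 => /orP[/eqP E|/eqP //].
  have := prim_order_dvd prim_w h; rewrite E eqxx.
  by move/(dvdn_leq h_gt0); lia.
rewrite exprAC wh -(signr_odd _ i); suff -> : odd i = ~~ is_sq (w ^+ i) by [].
apply/idP/idP => [oi|]; last first.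
  apply: contraR => ei; apply/existsP; exists (w ^+ i./2).
  by rewrite -exprM muln2 even_halfK.
apply/negP => /existsP[y /eqP y2].
have y0 : y != 0 by apply: contraNneq x0 => yz; rewrite wi -y2 yz expr0n.
have yN : y ^+ h.*2 = 1 by apply: (mulfI y0); rewrite -exprS -cF expf_card mulr1.
have [j yE] := prim_rootP prim_w yN.
move/eqP: y2; rewrite yE -exprM muln2 (eq_prim_root_expr prim_w) => /eqP e.
have := congr1 odd (divn_eq j.*2 h.*2); have := congr1 odd (divn_eq i h.*2).
by rewrite e !oddD !oddM !odd_double !andbF /= oi => <-.
Qed.

(** Rewriting the equation as a divisibility by [q] lets it pass from ['F_q] to any other ring of
    characteristic [q]. *)
Lemma natr_eq_sign (R : nzRingType) (q n : nat) (b : bool) : q \in [pchar R] ->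
  (n%:R == (-1) ^+ b :> R) = (q %| n + if b then 1 else q.-1)%N.
Proof.
move=> qR; rewrite (dvdn_pcharf qR) natrD; case: b; first by rewrite addr_eq0.
have -> : q.-1%:R = -1 :> R; last by rewrite subr_eq0.
apply/eqP; rewrite -addr_eq0 natr1 prednK ?prime_gt0 ?(pcharf_prime qR) //.
by rewrite (pcharf0 qR).
Qed.

Lemma pchar_odd_two_neq0 (F : fieldType) (p : nat) :
  p \in [pchar F] -> odd p -> 2%:R != 0 :> F.
Proof.
move=> cF op; rewrite -(dvdn_pcharf cF); apply: contraL op => /(@dvdn_leq _ 2 isT).
by have /prime_gt1 := pcharf_prime cF; case: p {cF} => [|[|[|]]].
Qed.

Lemma signr_inj_field (F : fieldType) (p : nat) (b c : bool) :
  p \in [pchar F] -> odd p -> (-1) ^+ b = (-1) ^+ c :> F -> b = c.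
Proof.
move=> cF op; have N1 : (-1 : F) != 1.
  apply: contraNneq (pchar_odd_two_neq0 cF op) => e.
  by rewrite mulr2n -{1}e addNr.
by case: b c => [] [] // /eqP; rewrite ?expr0 ?expr1 ?(negPf N1) // eq_sym (negPf N1).
Qed.

End FiniteFields.

(** The Legendre symbol; its target ring is free so that the Gauss sum can live in a finite field of
    another characteristic. *)
Definition leg (R : pzRingType) (p : nat) (a : 'F_p) : R :=
  (if a == 0 then 0 else (-1) ^+ (~~ is_sq a))%R.

Arguments leg R p a : clear implicits.

Section Reciprocity.
Local Open Scope ring_scope.

Variables (p : nat).
Hypotheses (p_pr : prime p) (p_odd : odd p).

Lemma card_Fp_odd : #|'F_p| = p./2.*2.+1.
Proof. by rewrite card_Fp // -{1}(odd_double_half p) p_odd. Qed.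

Lemma is_sqM (a b : 'F_p) : a != 0 -> b != 0 ->
  ~~ is_sq (a * b) = ~~ is_sq a (+) ~~ is_sq b.
Proof.
move=> a0 b0; apply: (signr_inj_field (pchar_Fp p_pr) p_odd).
by rewrite signr_addb -!(Euler_criterion card_Fp_odd) ?mulf_neq0 // exprMn.
Qed.

Lemma is_sq_N1 : ~~ is_sq (-1 : 'F_p) = odd p./2.
Proof.
apply: (signr_inj_field (pchar_Fp p_pr) p_odd).
by rewrite -(Euler_criterion card_Fp_odd) ?signr_odd // oppr_eq0 oner_neq0.
Qed.

Lemma legM (R : pzRingType) (a b : 'F_p) : leg R p (a * b) = leg R p a * leg R p b.
Proof.
rewrite /leg mulf_eq0; case: eqP => [|/eqP a0] /=; first by rewrite mul0r.
case: eqP => [|/eqP b0] /=; first by rewrite mulr0.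
by rewrite is_sqM // signr_addb.
Qed.

Lemma leg_exists_nonsq : exists a : 'F_p, a != 0 /\ ~~ is_sq a.
Proof.
have [w prim_w] : exists w : 'F_p, p./2.*2.-primitive_root w.
  apply: finField_prim_root; last by rewrite card_Fp_odd.
  by case: p p_pr p_odd => [|[|[|]]].
have w0 : w != 0.
  apply/eqP => w0; have := prim_expr_order prim_w; rewrite w0 expr0n.
  by rewrite eqn0Ngt (prim_order_gt0 prim_w) => /eqP; rewrite eq_sym oner_eq0.
exists w; split=> //; apply/negP => sq; have := Euler_criterion card_Fp_odd w0.
rewrite sq /= expr0 => /eqP; rewrite -(prim_order_dvd prim_w) => /dvdn_leq.
by have := prim_order_gt0 prim_w; rewrite double_gt0 => h0 /(_ h0); lia.
Qed.

(** Multiplying the index by a nonsquare negates the sum. *)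
Lemma sum_leg (R : idomainType) : 2%:R != 0 :> R -> \sum_(a : 'F_p) leg R p a = 0.
Proof.
move=> two0; have [w [w0 nsq]] := leg_exists_nonsq.
have: \sum_(a : 'F_p) leg R p a = - \sum_(a : 'F_p) leg R p a.
  rewrite [LHS](reindex_inj (mulfI w0)) /= -sumrN; apply: eq_bigr => a _.
  by rewrite legM /leg (negPf w0) nsq mulN1r.
by move/eqP; rewrite -addr_eq0 -mulr2n -mulr_natl mulf_eq0 (negPf two0) => /eqP.
Qed.

(** * Gauss sums in characteristic [q] *)

Section GaussSum.
Variables (q : nat) (K : finFieldType) (z : K).
Hypotheses (q_odd : odd q) (qK : q \in [pchar K]) (prim_z : p.-primitive_root z).

Let e (a : 'F_p) : K := z ^+ a.

Let eD a b : e (a + b) = e a * e b.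
Proof.
rewrite /e -exprD -(prim_expr_mod prim_z (a + b)%N); congr (_ ^+ _).
by rewrite -{1}(natr_Zp a) -{1}(natr_Zp b) -natrD val_Fp_nat.
Qed.

Let eMn n a : e (n%:R * a) = e a ^+ n.
Proof.
elim: n => [|n IHn]; first by rewrite mul0r.
by rewrite -addn1 natrD mulrDl mul1r eD IHn exprD.
Qed.

Let sum_e (b : 'F_p) : \sum_a e (a * b) = if b == 0 then p%:R else 0.
Proof.
case: eqP => [->|/eqP b0].
  rewrite (eq_bigr (fun=> 1)) => [|a _]; last by rewrite mulr0.
  by rewrite sumr_const card_Fp.
(* Shifting [a] by [b^-1] multiplies the sum by [z], which is not 1. *)
have : \sum_a e (a * b) = z * \sum_a e (a * b).
  rewrite [LHS](reindex_inj (addrI b^-1)) /= mulr_sumr; apply: eq_bigr => a _.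
  by rewrite mulrDl mulVf // eD; congr (_ * _).
move/eqP; rewrite -[X in X == _]mul1r -subr_eq0 -mulrBl mulf_eq0 subr_eq0.
case/orP => [/eqP z1|/eqP //].
have := prim_order_dvd prim_z 1; rewrite expr1 -z1 eqxx dvdn1.
by move/eqP=> p1; have := prime_gt1 p_pr; rewrite [in X in X -> _]p1.
Qed.

Definition gauss_sum := \sum_(a : 'F_p) leg K p a * e a.

(** Replacing the second index by [a c] cancels the symbols of [a]. The sum of [e (a (c + 1))] over
    [a <> 0] is then [-1], plus [p] when [c = -1]; the terms [-1] vanish by [sum_leg]. *)
Lemma gauss_sum_sq : gauss_sum ^+ 2 = leg K p (-1) * p%:R.
Proof.
transitivity (\sum_(a : 'F_p) \sum_(c : 'F_p) leg K p c * (if a == 0 then 0 else e (a * (c + 1)))).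
  rewrite expr2 {1}/gauss_sum mulr_suml; apply: eq_bigr => a _.
  case: (eqVneq a 0) => [->|a0].
    by rewrite {1}/leg eqxx !mul0r big1 // => c _; rewrite mulr0.
  rewrite /gauss_sum (reindex_inj (mulfI a0)) /= mulr_sumr.
  apply: eq_bigr => c _; rewrite legM // mulrDr mulr1 eD.
  have : leg K p a * leg K p a = 1 by rewrite /leg (negPf a0) -expr2 sqrr_sign.
  set la := leg K p a => la2; transitivity (la * la * (leg K p c * (e (a * c) * e a))).
    by ring.
  by rewrite la2 mul1r.
rewrite exchange_big /=.
rewrite (eq_bigr (fun c => leg K p c * (if c + 1 == 0 then p%:R else 0) - leg K p c)).
  rewrite sumrB (sum_leg (pchar_odd_two_neq0 qK q_odd)) subr0.
  rewrite (bigD1 (-1)) //= addNr eqxx big1 ?addr0 //.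
  by move=> c /negPf; rewrite addr_eq0 => ->; rewrite mulr0.
move=> c _; rewrite -sum_e -mulr_sumr -[X in _ - X]mulr1 -mulrBr; congr (_ * _).
rewrite (bigD1 0) //= ?eqxx ?add0r [in RHS](bigD1 0) //= mul0r.
rewrite addrAC subrr add0r; apply: eq_bigr => a /negPf -> //.
Qed.

(** The [q]-th power is additive, fixes signs because [q] is odd, and sends [e a] to [e (q a)];
    reindexing by [q] yields the factor. *)
Lemma gauss_sum_Frobenius : ~~ (p %| q)%N -> gauss_sum ^+ q = leg K p q%:R * gauss_sum.
Proof.
move=> pq; have q0 : (q%:R : 'F_p) != 0 by rewrite -(dvdn_pcharf (pchar_Fp p_pr)).
rewrite -(pFrobenius_autE qK) rmorph_sum /= mulr_sumr.
rewrite [RHS](reindex_inj (mulfI q0)) /=; apply: eq_bigr => a _.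
rewrite rmorphM /= !pFrobenius_autE eMn legM // !mulrA; congr (_ * _).
have leg2 : leg K p (q%:R : 'F_p) * leg K p q%:R = 1.
  by rewrite /leg (negPf q0) -expr2 sqrr_sign.
rewrite leg2 mul1r /leg; case: ifP => _; first by rewrite expr0n; case: (q) q_odd.
by rewrite exprAC -(signr_odd _ q) q_odd.
Qed.

Lemma gauss_sum_neq0 : ~~ (q %| p)%N -> gauss_sum != 0.
Proof.
move=> qp; rewrite -sqrf_eq0 gauss_sum_sq mulf_eq0 -(dvdn_pcharf qK) (negPf qp) orbF.
by rewrite /leg oppr_eq0 oner_eq0 signr_eq0.
Qed.

End GaussSum.

End Reciprocity.

(** By Euler, [n] divides [q ^ totient n - 1], the number of units of the field with [q ^ totient n]
    elements. *)
Lemma prim_root_field_exists q n : prime q -> 1 < n -> coprime q n ->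
  exists (K : finFieldType) (z : K), (q \in [pchar K] /\ n.-primitive_root z)%R.
Proof.
move=> q_pr n_gt1 co.
have t_gt0 : 0 < totient n by rewrite totient_gt0; lia.
have [K qK cK] := pPrimePowerField q_pr t_gt0; exists K.
have [|z prim_z] := @finField_prim_root K n (ltnW n_gt1); last by exists z.
by rewrite cK -subn1 -eqn_mod_dvd ?expn_gt0 ?prime_gt0 // eq_sym Euler_exp_totient // eq_sym.
Qed.

Definition nonres (p a : nat) := ~~ is_sq (a%:R : 'F_p)%R.

(** Two values of [tau ^ (q - 1)] are compared: Frobenius gives [(q / p)], while
    [tau ^ 2 = (-1 / p) p] and Euler's criterion modulo [q] give the other. *)
Theorem quadratic_reciprocity p q : prime p -> odd p -> prime q -> odd q -> p != q ->
  nonres q p = nonres p q (+) (odd p./2 && odd q./2).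
Proof.
move=> p_pr p_odd q_pr q_odd pq.
have pq' : ~~ (p %| q) by rewrite dvdn_prime2.
have qp' : ~~ (q %| p) by rewrite dvdn_prime2 // eq_sym.
have [||K [z [qK prim_z]]] := @prim_root_field_exists q p q_pr.
- exact: prime_gt1.
- by rewrite prime_coprime.
have tau0 := gauss_sum_neq0 p_pr p_odd q_odd qK prim_z qp'.
have Fr := gauss_sum_Frobenius p_pr p_odd q_odd qK prim_z pq'.
set tau := gauss_sum p z in tau0 Fr.
have tauq : (tau ^+ 2 ^+ q./2 = leg K p (q%:R : 'F_p))%R.
  apply: (mulIf tau0); rewrite -Fr -exprM -exprSr mul2n.
  by rewrite -{2}(odd_double_half q) q_odd.
have p0 : ((p%:R : 'F_q) != 0)%R by rewrite -(dvdn_pcharf (pchar_Fp q_pr)).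
have q0 : ((q%:R : 'F_p) != 0)%R by rewrite -(dvdn_pcharf (pchar_Fp p_pr)).
have pK : ((p%:R : K) ^+ q./2 = (-1) ^+ nonres q p)%R.
  apply/eqP; rewrite -natrX (natr_eq_sign _ _ qK).
  rewrite -(natr_eq_sign _ _ (pchar_Fp q_pr)) natrX.
  by rewrite (Euler_criterion (card_Fp_odd q_pr q_odd)).
move: tauq; rewrite (gauss_sum_sq p_pr p_odd q_odd qK prim_z) exprMn pK.
rewrite /leg oppr_eq0 oner_eq0 (negPf q0).
have signX (c : bool) n : (((-1) ^+ c) ^+ n = (-1) ^+ (c && odd n) :> K)%R.
  by case: c; rewrite ?expr1n // expr1 signr_odd.
rewrite is_sq_N1 // signX -signr_addb => /(signr_inj_field qK q_odd).
by rewrite -/(nonres p q) => <-; rewrite addbC addKb.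
Qed.

(** The same method with [tau = z + z^-1] for a primitive eighth root of unity [z]: [tau ^ 2 = 2],
    and Frobenius fixes or negates [tau] according to [q] mod 8. *)
Lemma nonres_two q : prime q -> odd q ->
  nonres q 2 = (q %% 8 == 3) || (q %% 8 == 5).
Proof.
move=> q_pr q_odd.
have [||K [z [qK prim_z]]] := @prim_root_field_exists q 8 q_pr.
- by [].
- by rewrite -[8]/(2 ^ 3) coprimeXr // coprimen2.
have z8 := prim_expr_order prim_z.
have z4 : (z ^+ 4 = -1)%R.
  have /eqP : (z ^+ 4 ^+ 2 = 1)%R by rewrite -exprM.
  rewrite sqrf_eq1 => /orP[/eqP z4|/eqP //].
  by have := prim_order_dvd prim_z 4; rewrite z4 eqxx.
have tau2 : ((z + z ^+ 7) ^+ 2 = 2%:R)%R.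
  transitivity (2%:R * z ^+ 8 + z ^+ 2 * (z ^+ 8 * z ^+ 4 + 1))%R; first by ring.
  by rewrite z8 z4; ring.
have two0 := pchar_odd_two_neq0 qK q_odd.
have tau0 : (z + z ^+ 7 != 0)%R by rewrite -sqrf_eq0 tau2.
have q8 : [|| q %% 8 == 1, q %% 8 == 3, q %% 8 == 5 | q %% 8 == 7] by lia.
have z5 : (z ^+ 5 = - z)%R by rewrite exprSr z4 mulN1r.
have z7 : (z ^+ 7 = - z ^+ 3)%R by rewrite (exprD z 4 3) z4 mulN1r.
have Fr : ((z + z ^+ 7) ^+ q = (-1) ^+ ((q %% 8 == 3) || (q %% 8 == 5))%N * (z + z ^+ 7))%R.
  rewrite -(pFrobenius_autE qK) rmorphD rmorphXn /= pFrobenius_autE -exprM.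
  rewrite -(prim_expr_mod prim_z) -(prim_expr_mod prim_z (q * 7)) -modnMml.
  case/or4P: q8 => /eqP ->; rewrite /= ?(expr0, expr1) -/(modn _ _).
  - by rewrite mul1r.
  - by rewrite -[((3 * 7) %% 8)%N]/5 z5 z7; ring.
  - by rewrite -[((5 * 7) %% 8)%N]/3 z5 z7; ring.
  - by ring.
have F2 : ((2%:R : 'F_q) != 0)%R by apply: pchar_odd_two_neq0 q_odd; apply: pchar_Fp.
have twoK : (2%:R ^+ q./2 = (-1) ^+ nonres q 2 :> K)%R.
  apply/eqP; rewrite -natrX (natr_eq_sign _ _ qK).
  rewrite -(natr_eq_sign _ _ (pchar_Fp q_pr)) natrX.
  by rewrite (Euler_criterion (card_Fp_odd q_pr q_odd)).
apply: (signr_inj_field qK q_odd); rewrite -twoK -tau2.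
apply: (mulIf tau0); rewrite -Fr -exprM -exprSr mul2n.
by rewrite -{2}(odd_double_half q) q_odd.
Qed.

(** * The Jacobi symbol and the character of [-2 k] *)

Lemma Fp_natr_eq0 p a : prime p -> ((a%:R : 'F_p) == 0)%R = (p %| a).
Proof. by move=> p_pr; rewrite -(dvdn_pcharf (pchar_Fp p_pr)). Qed.

Lemma nonres_mod p a b : prime p -> a = b %[mod p] -> nonres p a = nonres p b.
Proof.
by move=> p_pr ab; rewrite /nonres -(Fp_nat_mod p_pr a) ab Fp_nat_mod.
Qed.

Lemma nonresM p a b : prime p -> odd p -> coprime a p -> coprime b p ->
  nonres p (a * b) = nonres p a (+) nonres p b.
Proof.
move=> p_pr p_odd ap bp; rewrite /nonres natrM is_sqM // Fp_natr_eq0 //.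
  by rewrite -prime_coprime // coprime_sym.
by rewrite -prime_coprime // coprime_sym.
Qed.

Lemma nonres_N1 p a : prime p -> odd p -> p %| a.+1 -> nonres p a = odd p./2.
Proof.
move=> p_pr p_odd pa; rewrite -is_sq_N1 // /nonres; congr (~~ is_sq _).
by apply/eqP; rewrite -addr_eq0 natr1 Fp_natr_eq0.
Qed.

(** For odd [a], [odd a./2] means [a = 3] mod 4: it is the sign of the nontrivial character mod
    4. *)
Lemma odd_halfM a b : odd a -> odd b -> odd (a * b)./2 = odd a./2 (+) odd b./2.
Proof.
move=> oa ob; rewrite -{1}(odd_double_half a) -{1}(odd_double_half b) oa ob.
have -> : (true + a./2.*2) * (true + b./2.*2) = true + (a./2 + b./2 + (a./2 * b./2).*2).*2.
  by rewrite -!muln2 /=; ring.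
by rewrite (half_bit_double _ true) !oddD odd_double addbF.
Qed.

(* [J a] is the sign of the Jacobi symbol [(a / n)], [true] standing for [-1]. *)
Lemma Jacobi_exists n : odd n -> exists J : nat -> bool,
  [/\ forall a b, coprime a n -> coprime b n -> J (a * b) = J a (+) J b,
      forall a b, a = b %[mod n] -> J a = J b,
      forall q, prime q -> odd q -> coprime q n ->
        nonres q n = J q (+) (odd n./2 && odd q./2)
    & forall a, n %| a.+1 -> J a = odd n./2].
Proof.
elim/ltn_ind: n => n IHn n_odd.
have n_gt0 : 0 < n by case: n n_odd {IHn}.
have [n_le1|n_gt1] := leqP n 1.
  have -> : n = 1 by lia.
  exists (fun=> false); split=> // q q_pr _ _.
  by rewrite /nonres; apply/negbF/existsP; exists 1%R; rewrite expr1n.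
have [p_pr /dvdnP[n' def_n]] : prime (pdiv n) /\ pdiv n %| n.
  by rewrite pdiv_prime // pdiv_dvd.
move: (pdiv n) p_pr def_n => p p_pr def_n; rewrite {n}def_n in IHn n_odd n_gt0 n_gt1 *.
have [n'_odd p_odd] : odd n' /\ odd p by apply/andP; rewrite -oddM.
have p_gt1 := prime_gt1 p_pr.
have [|//|J [JM Jmod Jq JN1]] := IHn n'.
  by rewrite ltn_Pmulr //; case: (n') n'_odd.
exists (fun a => J a (+) nonres p a); split.
- move=> a b; rewrite !coprimeMr => /andP[an ap] /andP[bn bp].
  by rewrite JM // nonresM // addbACA.
- move=> a b ab; rewrite (Jmod a b) 1?(@nonres_mod p a b) //.
    by rewrite -(modn_dvdm a (dvdn_mull n' (dvdnn p))) ab modn_dvdm ?dvdn_mull.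
  by rewrite -(modn_dvdm a (dvdn_mulr p (dvdnn n'))) ab modn_dvdm ?dvdn_mulr.
- move=> q q_pr q_odd; rewrite coprimeMr => /andP[qn qp].
  rewrite nonresM 1?coprime_sym // Jq // quadratic_reciprocity //.
    rewrite odd_halfM //.
    by case: (odd n'./2) (odd p./2) (odd q./2) (J q) (nonres p q) => [] [] [] [] [].
  by apply: contraTneq qp => ->; rewrite prime_coprime // dvdnn.
- move=> a na; rewrite odd_halfM // JN1 ?nonres_N1 //.
    by apply: dvdn_trans na; apply: dvdn_mull.
  by apply: dvdn_trans na; apply: dvdn_mulr.
Qed.

Lemma nonres_two_mod8M a b : odd a -> odd b ->
  ((a * b %% 8 == 3) || (a * b %% 8 == 5))
  = ((a %% 8 == 3) || (a %% 8 == 5)) (+) ((b %% 8 == 3) || (b %% 8 == 5)).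
Proof.
move=> oa ob; rewrite -modnMm.
have : [|| a %% 8 == 1, a %% 8 == 3, a %% 8 == 5 | a %% 8 == 7] by lia.
have : [|| b %% 8 == 1, b %% 8 == 3, b %% 8 == 5 | b %% 8 == 7] by lia.
by case/or4P => /eqP ->; case/or4P => /eqP ->.
Qed.

Lemma chi_exists k : odd k -> exists chi : nat -> int,
  [/\ forall a b, chi (a * b)%N = (chi a * chi b)%R,
      forall a b, a = b %[mod 8 * k] -> chi a = chi b,
      forall a, (chi a ^+ 2 = (coprime a (8 * k))%:R)%R,
      forall q, prime q -> coprime q (8 * k) ->
        chi q = 1%R <-> exists B, q %| B ^ 2 + 2 * k
    & forall g, g %% 8 = 3 -> k %| g.+1 -> chi g = 1%R].
Proof.
move=> k_odd; have [J [JM Jmod Jq JN1]] := Jacobi_exists k_odd.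
(* The sign of [(-2k / d)]: reciprocity turns [(k / d)] into [(d / k)] and a sign, which merges with
   [(-1 / d)] into the middle term; the last term is [(2 / d)]. *)
pose s d := J d (+) (odd d./2 && ~~ odd k./2) (+) ((d %% 8 == 3) || (d %% 8 == 5)).
have co a : coprime a (8 * k) = odd a && coprime a k.
  by rewrite coprimeMr -[8]/(2 ^ 3) coprime_pexpr // coprimen2.
exists (fun a => if coprime a (8 * k) then (-1) ^+ s a else 0)%R; split.
- move=> a b; rewrite coprimeMl; case: ifP; last first.
    by case: coprime => /=; [move=> -> |]; rewrite ?mul0r ?mulr0.
  case/andP=> ha hb; rewrite ha hb -signr_addb; congr (_ ^+ nat_of_bool _)%R.
  move: ha hb; rewrite !co => /andP[oa ca] /andP[ob cb].
  rewrite /s JM // odd_halfM // nonres_two_mod8M //.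
  by case: (J a) (J b) (odd a./2) (odd b./2) (odd k./2) (_ || _) (_ || _)
    => [] [] [] [] [] [] [].
- move=> a b ab; rewrite -(coprime_modl a) ab coprime_modl; case: ifP => // _.
  have ab8 : a = b %[mod 8].
    by rewrite -(modn_dvdm a (dvdn_mulr k (dvdnn 8))) ab modn_dvdm ?dvdn_mulr.
  have abk : a = b %[mod k].
    by rewrite -(modn_dvdm a (dvdn_mull 8 (dvdnn k))) ab modn_dvdm ?dvdn_mull.
  have oh x : odd x./2 = odd (x %% 8)./2.
    by rewrite {1}(divn_eq x 8) -[8]/(4.*2) -doubleMr halfD odd_double /= doubleK add0n
      oddD (_ : odd (x %/ 4.*2 * 4) = false) // oddM andbF.
  by rewrite /s (Jmod a b) // (oh a) (oh b) ab8.
- by move=> a; case: ifP; rewrite ?sqrr_sign ?expr0n.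
- move=> q q_pr coq; rewrite coq; move: coq; rewrite co => /andP[q_odd qk].
  have -> : s q = ~~ is_sq (- (2 * k)%:R : 'F_q)%R.
    have N1 : ((-1 : 'F_q) != 0)%R by rewrite oppr_eq0 oner_eq0.
    have two0 : ((2%:R : 'F_q) != 0)%R.
      exact: pchar_odd_two_neq0 (pchar_Fp q_pr) q_odd.
    have k0 : ((k%:R : 'F_q) != 0)%R by rewrite Fp_natr_eq0 // -prime_coprime.
    rewrite -mulN1r natrM !is_sqM ?mulf_neq0 // is_sq_N1 //.
    rewrite -/(nonres q 2) -/(nonres q k).
    rewrite nonres_two // Jq // /s.
    by case: (J q) (odd k./2) (odd q./2) (_ || _) => [] [] [] [].
  split=> [|[B dvB]].
    case: (boolP (is_sq _)) => [/existsP[y /eqP y2] _|_ /eqP]; last by rewrite expr1.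
    exists (nat_of_ord y); rewrite -Fp_natr_eq0 //.
    by rewrite natrD natrX natr_Zp y2 addNr.
  suff -> : is_sq (- (2 * k)%:R : 'F_q)%R by [].
  apply/existsP; exists B%:R%R; rewrite -addr_eq0 -natrX -natrD.
  by rewrite Fp_natr_eq0.
- move=> g g8 kg; have g_odd : odd g by lia.
  have -> : coprime g (8 * k).
    by rewrite co g_odd (coprime_dvdr kg) // coprimenS.
  rewrite /s JN1 // g8; have -> : odd g./2 by lia.
  by case: (odd _).
Qed.

(** * Divisor sums of a quadratic character *)

Section ResidueCount.
Variables (m c : nat).
Hypotheses (m_gt0 : 0 < m) (co_c : coprime c m).

Lemma eqn_modMl_coprime x y : (c * x == c * y %[mod m]) = (x == y %[mod m]).
Proof.
wlog le_yx : x y / y <= x => [W|].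
  by case: (leqP y x) => [|/ltnW] /W // e; rewrite eq_sym e eq_sym.
by rewrite !eqn_mod_dvd ?leq_mul2l ?le_yx ?orbT // -mulnBr Gauss_dvdr // coprime_sym.
Qed.

Lemma count_period lo g : \sum_(x < m) (c * (lo + x) == g %[mod m]) = 1.
Proof.
pose f (x : 'I_m) := Ordinal (ltn_pmod (c * (lo + x)) m_gt0).
have f_inj : injective f.
  move=> x y /(congr1 val) /= /eqP; rewrite eqn_modMl_coprime eqn_modDl.
  by rewrite !modn_small // => /eqP/val_inj.
pose r := Ordinal (ltn_pmod g m_gt0).
transitivity (\sum_(y < m) (y == r)).
  by rewrite [RHS](reindex_inj f_inj); apply: eq_bigr.
by rewrite (bigD1 r) //= eqxx big1 ?addn0 // => y /negPf ->.
Qed.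

(** Each full period adds one to both counts; the incomplete one adds at most one to either. *)
Lemma count_residues_leq lo len g h :
  \sum_(x < len) (c * (lo + x) == g %[mod m]) <=
  (\sum_(x < len) (c * (lo + x) == h %[mod m])).+1.
Proof.
elim/ltn_ind: len lo => len IH lo; case: (ltnP len m) => [lt_len|le_len].
  apply: leq_trans (_ : 1 <= _) => //; rewrite -(count_period lo g).
  by rewrite -(subnKC (ltnW lt_len)) big_split_ord leq_addr.
rewrite -(subnKC le_len) !big_split_ord /= !count_period !add1n ltnS.
under eq_bigr => x _ do rewrite addnA.
under [in leqRHS]eq_bigr => x _ do rewrite addnA.
by apply: IH; lia.
Qed.

End ResidueCount.

Section QuadraticCharacter.
Local Open Scope ring_scope.
Import Order.TTheory Num.Theory.

Variables (m : nat) (chi : nat -> int).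
Hypotheses (m_gt1 : (1 < m)%N)
  (chiM : forall a b, chi (a * b)%N = chi a * chi b)
  (chi_mod : forall a b, (a = b %[mod m])%N -> chi a = chi b)
  (chi_sq : forall a, chi a ^+ 2 = (coprime a m)%:R).

Lemma chi1 : chi 1 = 1.
Proof.
have := chiM 1 1; have := chi_sq 1; rewrite coprime1n muln1 expr2 => e1 e2.
by rewrite e2.
Qed.

Lemma chi_pm1 a : coprime a m -> (chi a = 1) \/ (chi a = -1).
Proof.
move=> ca; have /eqP := chi_sq a; rewrite ca sqrf_eq1.
by case/orP => /eqP; [left | right].
Qed.

Lemma PoszD_sum n (F : 'I_n -> nat) : (\sum_(i < n) F i)%N%:Z = \sum_(i < n) (F i)%:Z.
Proof. by rewrite -[LHS]natz natr_sum; apply: eq_bigr => i _; rewrite natz. Qed.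

Definition divsum (t : nat) : int := \sum_(d <- divisors t) chi d.

(** One line of lattice points under the hyperbola [c x = X]; [lo] is 0 in one half of the hyperbola
    method and [N + 1] in the other. *)
Definition fiber (X g lo c : nat) : int :=
  \sum_(lo <= x < X.+1 | (c * x < X.+1)%N && (c * x == g %[mod m])%N) chi c.

Lemma fiber_count (X g lo c : nat) :
  fiber X g lo c =
  chi c * (\sum_(x < (X %/ c).+1 - lo) (c * (lo + x) == g %[mod m])%N)%:Z.
Proof.
have [cc|ncc] := boolP (coprime c m); last first.
  have /eqP := chi_sq c; rewrite (negPf ncc) sqrf_eq0 => /eqP c0.
  by rewrite /fiber c0 mul0r big1.
have c_gt0 : (0 < c)%N.
  by case: (c) cc => //; rewrite /coprime gcd0n => /eqP m1; move: m_gt1; rewrite m1.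
rewrite /fiber (eq_bigl (fun x => (c * x == g %[mod m])%N && (x < (X %/ c).+1)%N)); last first.
  by move=> x; rewrite andbC !ltnS leq_divRL // mulnC.
rewrite -(@big_nat_widen _ _ _ lo (X %/ c).+1 X.+1) ?ltnS ?leq_div //.
rewrite big_mkcond -{1}[lo]add0n big_addn big_mkord PoszD_sum mulr_sumr.
apply: eq_bigr => x _; rewrite addnC; case: (_ == _); by rewrite ?mulr1 ?mulr0.
Qed.

Lemma fiber_dist (X g h lo c : nat) :
  `|fiber X g lo c - fiber X h lo c| <= 1.
Proof.
rewrite !fiber_count //.
have [cc|ncc] := boolP (coprime c m); last first.
  have /eqP := chi_sq c; rewrite (negPf ncc) sqrf_eq0 => /eqP ->.
  by rewrite !mul0r subrr normr0.
rewrite -mulrBr normrM; have -> : `|chi c| = 1.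
  by case: (chi_pm1 cc) => ->; rewrite ?normrN normr1.
have m_gt0 := ltnW m_gt1.
have := count_residues_leq m_gt0 cc lo ((X %/ c).+1 - lo) g h.
have := count_residues_leq m_gt0 cc lo ((X %/ c).+1 - lo) h g.
by lia.
Qed.

Definition class_sum (X g : nat) : int :=
  \sum_(0 <= t < X.+1 | (t == g %[mod m])%N) divsum t.

Lemma divsum_range (X t : nat) : (0 < t)%N -> (t <= X)%N ->
  divsum t = \sum_(0 <= d < X.+1 | (d %| t)%N) chi d.
Proof.
move=> t_gt0 tX; rewrite /divsum -[RHS]big_filter; apply: perm_big.
apply: uniq_perm; rewrite ?filter_uniq ?divisors_uniq ?iota_uniq // => d.
rewrite mem_filter -dvdn_divisors // mem_index_iota /= andbC.
by case: (boolP (_ %| _)%N) => [/(dvdn_leq t_gt0)|]; rewrite ?andbF // andbT ltnS => /leq_trans ->.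
Qed.

Lemma class_sum_pairs (X g : nat) : coprime g m ->
  class_sum X g = \sum_(0 <= a < X.+1) \sum_(0 <= b < X.+1 |
    (a * b < X.+1)%N && (a * b == g %[mod m])%N) chi b.
Proof.
move=> cg; rewrite /class_sum.
transitivity (\sum_(0 <= t < X.+1 | (t == g %[mod m])%N)
  \sum_(0 <= a < X.+1) \sum_(0 <= b < X.+1) if (a * b == t)%N then chi b else 0).
  rewrite big_nat_cond [RHS]big_nat_cond; apply: eq_bigr => t /andP[/= tX tg].
  have t_gt0 : (0 < t)%N.
    case: t tg {tX} => // /eqP tg; move: cg; rewrite -coprime_modl -tg mod0n.
    by rewrite /coprime gcd0n => /eqP m1; move: m_gt1; rewrite m1.
  rewrite (@divsum_range X) // exchange_big /= big_mkcond; apply: eq_big_nat => b bX.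
  have [/dvdnP[a def_t]|ndv] := boolP (_ %| _)%N; last first.
    rewrite big1 // => a _; case: eqP => // ab.
    by move: ndv; rewrite -ab dvdn_mull.
  have b_gt0 : (0 < b)%N by move: t_gt0; rewrite def_t muln_gt0 => /andP[].
  rewrite -big_mkcond (eq_bigl (fun i => i == a)) => [|i]; last first.
    by rewrite def_t eqn_pmul2r.
  rewrite big_nat1_eq ifT //= -ltnS; move: tX; rewrite def_t /= !ltnS => ?.
  by apply: leq_trans (leq_pmulr _ b_gt0) _.
rewrite exchange_big /=; apply: eq_big_nat => a aX.
rewrite exchange_big /= [RHS]big_mkcond; apply: eq_big_nat => b bX.
rewrite -big_mkcondr (eq_bigl (fun t => (t == g %[mod m])%N && (t == a * b)%N)) => [|t].
  rewrite big_nat1_cond_eq /= andbC.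
  by case: (_ == _ %[mod m])%N.
by rewrite (eq_sym (a * b)%N).
Qed.

(* Dirichlet's hyperbola method: the pairs [a * b <= N ^ 2] either have [a <= N],
   or [N < a] and [b <= N]; in the class of [g] one has [chi a = chi b]. *)
Lemma class_sum_hyperbola (N g : nat) : coprime g m -> chi g = 1 ->
  class_sum (N ^ 2) g =
  \sum_(a < N.+1) fiber (N ^ 2) g 0 a + \sum_(b < N.+1) fiber (N ^ 2) g N.+1 b.
Proof.
move=> cg g1; have NX : (N.+1 <= (N ^ 2).+1)%N by rewrite ltnS -mulnn; nia.
rewrite class_sum_pairs // (big_cat_nat (leq0n _) NX) /=; congr (_ + _).
  rewrite big_mkord; apply: eq_bigr => a _; apply: eq_bigr => b /andP[_ /eqP ab].
  have e : chi a * chi b = 1 by rewrite -chiM (chi_mod ab).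
  have ca : coprime a m.
    by apply: (@coprime_dvdl _ (a * b)); rewrite ?dvdn_mulr // -coprime_modl ab coprime_modl.
  rewrite -[LHS]mul1r -[X in X * _ = _](_ : chi a ^+ 2 = 1); last by rewrite chi_sq ca.
  by rewrite expr2 -mulrA e mulr1.
rewrite -(big_mkord xpredT (fiber (N ^ 2) g N.+1)) /fiber.
transitivity (\sum_(N.+1 <= a < (N ^ 2).+1) \sum_(0 <= b < N.+1 |
    (a * b < (N ^ 2).+1)%N && (a * b == g %[mod m])%N) chi b).
  apply: eq_big_nat => a /andP[Na _]; rewrite [RHS](big_nat_widen _ _ _ _ _ NX).
  apply: eq_bigl => b; case: (boolP (a * b < _)%N) => //= ab.
  suff -> : (b < N.+1)%N by rewrite andbT.
  nia.
under eq_bigr => a _ do rewrite big_mkcond.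
rewrite exchange_big; apply: eq_bigr => b _; rewrite -big_mkcond /=.
by apply: eq_bigl => a; rewrite mulnC.
Qed.

(** The hyperbola method writes both sums with [2 (N + 1)] fibers, and corresponding fibers differ
    by at most 1. *)
Lemma class_sum_dist (N g h : nat) :
  coprime g m -> chi g = 1 -> coprime h m -> chi h = 1 ->
  `|class_sum (N ^ 2) g - class_sum (N ^ 2) h| <= (2 * N + 2)%:Z.
Proof.
move=> cg g1 ch h1; rewrite !class_sum_hyperbola // opprD addrACA -!sumrB.
apply: le_trans (ler_normD _ _) _.
have bound lo : `|\sum_(a < N.+1) (fiber (N ^ 2) g lo a - fiber (N ^ 2) h lo a)| <= N.+1%:Z.
  apply: le_trans (ler_norm_sum _ _ _) _.
  apply: (@le_trans _ _ (\sum_(a < N.+1) 1)); last by rewrite sumr_const card_ord natz.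
  by apply: ler_sum => a _; apply: fiber_dist.
by apply: le_trans (lerD (bound 0%N) (bound N.+1)) _; lia.
Qed.

(** * Values and positivity of the divisor sum *)

Lemma perm_divisors_pM p n : prime p -> (0 < n)%N -> forall j, ~~ (p %| n)%N ->
  perm_eq (divisors (p ^ j.+1 * n)) ([seq (p * d)%N | d <- divisors (p ^ j * n)] ++ divisors n).
Proof.
move=> p_pr n_gt0 j pn; have p_gt0 := prime_gt0 p_pr.
have pj_gt0 i : (0 < p ^ i * n)%N by rewrite muln_gt0 expn_gt0 p_gt0.
apply: uniq_perm.
- exact: divisors_uniq.
- rewrite cat_uniq !divisors_uniq map_inj_uniq ?divisors_uniq ?andbT /=; last first.
    by move=> x y /eqP; rewrite eqn_pmul2l // => /eqP.
  apply/hasPn => d; rewrite -dvdn_divisors // => dn; apply/mapP => -[e _ de].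
  by move: pn; rewrite (dvdn_trans _ dn) // de dvdn_mulr.
move=> d; rewrite mem_cat -!dvdn_divisors //.
apply/idP/orP => [dv|[/mapP[e]|dn]]; last 2 first.
- by rewrite -dvdn_divisors // => de ->; rewrite expnS -mulnA dvdn_pmul2l.
- by rewrite dvdn_mull.
have [/dvdnP[e de]|pd] := boolP (p %| d)%N.
  left; apply/mapP; exists e; last by rewrite mulnC.
  by rewrite -dvdn_divisors // -(dvdn_pmul2l p_gt0) mulnA -expnS mulnC -de.
by right; move: dv; rewrite Gauss_dvdr // coprimeXr // coprime_sym prime_coprime.
Qed.

Lemma divsum_pM p n j : prime p -> (0 < n)%N -> ~~ (p %| n)%N ->
  divsum (p ^ j.+1 * n) = chi p * divsum (p ^ j * n) + divsum n.
Proof.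
move=> p_pr n_gt0 pn; rewrite /divsum (perm_big _ (perm_divisors_pM p_pr n_gt0 j pn)).
rewrite big_cat big_map /= mulr_sumr; congr (_ + _).
by apply: eq_bigr => d _; rewrite chiM.
Qed.

Lemma divsum_split p n j : prime p -> (0 < n)%N -> ~~ (p %| n)%N -> chi p = 1 ->
  divsum (p ^ j * n) = j.+1%:R * divsum n.
Proof.
move=> p_pr n_gt0 pn p1; elim: j => [|j IH]; first by rewrite mul1n mul1r.
by rewrite divsum_pM // p1 IH -[j.+2%:R]natr1 mulrDl !mul1r.
Qed.

Lemma divsum_inert p n j : prime p -> (0 < n)%N -> ~~ (p %| n)%N -> chi p = -1 ->
  divsum (p ^ j * n) = (~~ odd j)%:R * divsum n.
Proof.
move=> p_pr n_gt0 pn p1; elim: j => [|j IH]; first by rewrite mul1n mul1r.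
rewrite divsum_pM // p1 IH /=; case: (odd j) => /=; first by rewrite mul0r mulr0 mul1r add0r.
by rewrite mul0r !mul1r mulN1r addNr.
Qed.

Variable M : nat.
Hypothesis chi_res : forall q, prime q -> coprime q m ->
  chi q = 1 <-> exists B, (q %| B ^ 2 + M)%N.

(** An odd power of a prime with [chi p = -1] makes the sum vanish. So when it is positive, all
    primes of odd exponent have [chi p = 1]; [A] is their product, and roots of [-M] modulo them are
    glued by the Chinese remainder theorem. *)
Lemma divsum_gt0 t : (0 < t)%N -> coprime t m -> 0 <= divsum t /\
  (0 < divsum t -> exists A s B, (t = A * s ^ 2)%N /\ (A %| B ^ 2 + M)%N).
Proof.
elim/ltn_ind: t => t IH t_gt0 co_t; have [t_le1|t_gt1] := leqP t 1.
  have -> : t = 1%N by lia.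
  rewrite /divsum big_seq1 chi1; split=> // _.
  by exists 1%N, 1%N, 0%N; rewrite dvd1n.
have p_pr := pdiv_prime t_gt1; have pt := pdiv_dvd t.
have [s ps def_t] := pfactor_coprime p_pr t_gt0.
move: (pdiv t) p_pr pt ps def_t => p p_pr pt; rewrite prime_coprime // => ps def_t.
have : (0 < logn p t)%N by rewrite logn_gt0 mem_primes p_pr t_gt0.
move: (logn p t) def_t => j def_t j_gt0.
have s_gt0 : (0 < s)%N by move: t_gt0; rewrite def_t muln_gt0 => /andP[].
have p_gt1 := prime_gt1 p_pr.
have lt_st : (s < t)%N by rewrite def_t ltn_Pmulr // -(exp1n j) ltn_exp2r.
have co_s : coprime s m by apply: coprime_dvdl co_t; rewrite def_t dvdn_mulr.
have co_p : coprime p m by apply: coprime_dvdl co_t.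
have [R_ge0 R_gt0] := IH s lt_st s_gt0 co_s.
have sq_step : (~~ odd j) -> 0 < divsum s ->
  exists A s' B, (t = A * s' ^ 2)%N /\ (A %| B ^ 2 + M)%N.
  move=> ej /R_gt0[A [s' [B [def_s AB]]]]; exists A, (p ^ j./2 * s')%N, B; split=> //.
  by rewrite def_t def_s expnMn -expnM muln2 even_halfK // mulnA mulnAC.
rewrite def_t mulnC; case: (chi_pm1 co_p) => chi_p; last first.
  rewrite divsum_inert //; case: (boolP (odd j)) => oj /=.
    by rewrite mul0r ltxx; split.
  by rewrite mul1r mulnC -def_t; split=> // Rs; apply: sq_step.
rewrite divsum_split // mulr_ge0 //; split=> //.
rewrite pmulr_rgt0 ?ltr0Sn // mulnC -def_t => Rs.
have [oj|ej] := boolP (odd j); last exact: sq_step.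
have [A [s' [B [def_s AB]]]] := R_gt0 Rs.
have [B0 pB0] := (chi_res p_pr co_p).1 chi_p.
have co_pA : coprime p A.
  by rewrite prime_coprime //; apply: contra ps => pA; rewrite def_s dvdn_mulr.
exists (p * A)%N, (p ^ j./2 * s')%N, (chinese p A B0 B); split.
  rewrite def_t def_s expnMn -expnM muln2 -{1}(odd_double_half j) oj add1n (expnS p).
  by ring.
rewrite Gauss_dvd // /dvdn -(modnDml (_ ^ 2)) -modnXm chinese_modl // modnXm modnDml.
rewrite -/(dvdn _ _) pB0 /= -(modnDml (_ ^ 2)) -modnXm chinese_modr // modnXm modnDml.
exact: AB.
Qed.

(** The value is 1 mod [m], so a prime [p] dividing it is prime to [m], and [u / m ^ i] is a square
    root of [-M] mod [p]. Hence [chi] is 1 on every divisor. *)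
Lemma divsum_norm_form (u i : nat) : u = 1 %[mod m] -> (0 < i)%N ->
  1 <= divsum (u ^ 2 + M * (m ^ i) ^ 2).
Proof.
move=> u1 i_gt0; set t := (_ + _)%N.
have m_my : (m %| m ^ i)%N by rewrite dvdn_exp.
have t1 : (t = 1 %[mod m])%N.
  rewrite -modnDmr -[(_ ^ 2)%N in X in (_ + X)%N]mulnn mulnA -modnMmr (eqP m_my) muln0 mod0n addn0.
  by rewrite -modnXm u1 modnXm exp1n.
have co_t : coprime t m by rewrite -coprime_modl t1 coprime_modl coprime1n.
have t_gt0 : (0 < t)%N.
  rewrite lt0n; apply/eqP => t0; move: co_t; rewrite t0 /coprime gcd0n => /eqP m1.
  by move: m_gt1; rewrite m1.
have chi_prime p : prime p -> (p %| t)%N -> chi p = 1.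
  move=> p_pr pt; have co_p : coprime p m by apply: coprime_dvdl co_t.
  apply/chi_res => //; have : coprime (m ^ i) p by rewrite coprimeXl // coprime_sym.
  have y_gt0 : (0 < m ^ i)%N by rewrite expn_gt0 ltnW.
  case/(coprimeP _ y_gt0) => -[a b] /= ab.
  (* [a] inverts [m ^ i] mod [p]; the added multiple of [p] completes [(u a)^2 + M] to exactly
     [a ^ 2 * t]. *)
  exists (u * a)%N; rewrite -(@dvdn_addl (M * p * (b * (b * p + 2))))%N; last first.
    by rewrite -mulnA mulnCA dvdn_mulr.
  have -> : ((u * a) ^ 2 + M + M * p * (b * (b * p + 2)) = a ^ 2 * t)%N.
    have {}ab : (a * m ^ i = b * p + 1)%N by lia.
    have -> : (a ^ 2 * t = (u * a) ^ 2 + M * (a * m ^ i) ^ 2)%N by rewrite /t; ring.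
    by rewrite ab; ring.
  by rewrite dvdn_mull.
have chi_dvd d : (d %| t)%N -> chi d = 1.
  elim/ltn_ind: d => d IH dt; have d_gt0 := dvdn_gt0 t_gt0 dt.
  have [d_le1|d_gt1] := leqP d 1; first by rewrite (_ : d = 1%N) ?chi1 //; lia.
  have p_pr := pdiv_prime d_gt1; have /dvdnP[e de] := pdiv_dvd d.
  rewrite de chiM (chi_prime _ p_pr) ?mulr1; last exact: dvdn_trans (pdiv_dvd d) dt.
  apply: IH; last by apply: dvdn_trans dt; rewrite [X in (_ %| X)%N]de dvdn_mulr.
  by rewrite [ltnRHS]de ltn_Pmulr ?prime_gt1 //; move: d_gt0; rewrite de muln_gt0 => /andP[].
rewrite /divsum big_seq (eq_bigr (fun=> 1)) => [|d]; last first.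
  by rewrite -dvdn_divisors // => /chi_dvd.
rewrite -big_seq (big_rem 1%N) /= ?lerDl ?sumr_ge0 //.
by rewrite -dvdn_divisors // dvd1n.
Qed.

Lemma coprime_class_gt0 g t : coprime g m -> t = g %[mod m] -> (0 < t)%N.
Proof.
move=> cg tg; rewrite lt0n; apply/eqP => t0; move: cg.
rewrite -coprime_modl -tg t0 mod0n /coprime gcd0n => /eqP m1.
by move: m_gt1; rewrite m1.
Qed.

(* The numbers [u ^ 2 + M * m ^ (2 i)] with [u = 1 %[mod m]] and [1 <= i <= K] are
   in the class of [1] and have a positive divisor sum; they are pairwise distinct
   once [u] exceeds [B]. *)
Lemma class_sum_lower (B J K : nat) :
  (B = M * (m ^ K.+1) ^ 2)%N -> (0 < M)%N ->
  (K * J)%:Z <= class_sum ((m * (B + J)).+1 ^ 2) 1.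
Proof.
move=> def_B M_gt0; set N := (m * (B + J)).+1; set X := (N ^ 2)%N.
have m_gt0 := ltnW m_gt1.
pose y (i : nat) := (M * (m ^ i.+1) ^ 2)%N.
pose u (j : nat) := (m * (B + j)).+1.
have yB i : (i < K)%N -> (y i < B)%N.
  by move=> iK; rewrite def_B /y ltn_pmul2l // ltn_exp2r // ltn_exp2l.
have u_mono j j' : (j < j')%N -> (u j < u j')%N.
  by move=> jj; rewrite /u ltnS ltn_pmul2l // ltn_add2l.
have u_ge j : (B < u j)%N by rewrite /u ltnS; nia.
(* Since [u j > B], the gap from [u j ^ 2] to the next square exceeds every [y i]. *)
have between i j j' : (i < K)%N -> (j < j')%N -> (u j ^ 2 + y i < u j' ^ 2)%N.
  move=> /yB yi /u_mono; have := u_ge j; move: (u j) (u j') (y i) yi => a b c.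
  by rewrite -!mulnn; nia.
pose f (p : 'I_K * 'I_J) : 'I_X.+1 := inord (u p.2 ^ 2 + y p.1).
(* As [N = u J], [between] keeps the value below [N ^ 2], so [inord] does not fall back to its
   default. *)
have fE p : f p = (u p.2 ^ 2 + y p.1)%N :> nat.
  rewrite inordK // ltnS; apply: ltnW; apply: leq_trans (between _ _ J _ _) _ => //.
have f_inj : injective f.
  move=> [i j] [i' j'] /(congr1 val) /=; rewrite !fE /= => e.
  have jj : j = j' :> nat.
    case: (ltngtP j j') => //.
      by move/(between _ _ _ (ltn_ord i)); rewrite e ltnNge leq_addr.
    by move/(between _ _ _ (ltn_ord i')); rewrite -e ltnNge leq_addr.
  move: e; rewrite jj => /addnI /eqP; rewrite /y eqn_pmul2l // eqn_exp2r //.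
  by rewrite eqn_exp2l // eqSS => /eqP ii; congr (_, _); apply: val_inj.
have f1 p : (f p == 1 %[mod m])%N.
  apply/eqP; rewrite fE.
  have -> : (u p.2 ^ 2 + y p.1 =
      m * ((B + p.2) * (u p.2).+1 + M * m ^ p.1 * (m * m ^ p.1)) + 1)%N.
    by rewrite /u /y (expnS m); ring.
  by rewrite mulnC modnMDl.
rewrite /class_sum big_mkord -[K]card_ord -[X in (_ * X)%N]card_ord -card_prod.
rewrite -(card_imset predT f_inj) -natz -sumr_const big_mkcond [leRHS]big_mkcond.
apply: ler_sum => t _; case: imsetP => [[p _ ->]|_].
  rewrite f1 fE; apply: divsum_norm_form => //.
  by rewrite /u -addn1 mulnC modnMDl.
case: eqP => // t1; have co_t : coprime t m by rewrite -coprime_modl t1 coprime_modl coprime1n.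
by have [] := divsum_gt0 (coprime_class_gt0 (coprime1n m) t1) co_t.
Qed.

Theorem exists_in_class g : (0 < M)%N -> coprime g m -> chi g = 1 ->
  exists A s B, [/\ (A * s ^ 2 = g %[mod m])%N, (A %| B ^ 2 + M)%N & (0 < A)%N].
Proof.
move=> M_gt0 co_g g1.
(* The lower bound [K J] must exceed [2 N + 2 = 2 m (B + J) + 4]; with [K = 4 m] this holds for [J]
   slightly above [B]. *)
pose K := (4 * m)%N; pose B := (M * (m ^ K.+1) ^ 2)%N; pose J := (B + 3)%N.
pose N := (m * (B + J)).+1.
have low : (K * J)%:Z <= class_sum (N ^ 2) 1 := class_sum_lower J (erefl B) M_gt0.
have dist := class_sum_dist N co_g g1 (coprime1n m) chi1.
have pos : 0 < class_sum (N ^ 2) g.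
  have : (2 * N + 2)%:Z < (K * J)%:Z by rewrite ltz_nat /K /N /J; nia.
  by move: dist; rewrite ler_norml => /andP[]; lia.
have [t tg t_gt0] : exists2 t, (t = g %[mod m])%N & 0 < divsum t.
  pose P t := (t == g %[mod m])%N && (0 < divsum t).
  have [/hasP[t _ /andP[/eqP tg t_gt0]]|/hasPn noP] := boolP (has P (index_iota 0 (N ^ 2).+1)).
    by exists t.
  move: pos; rewrite ltNge => /negP[]; rewrite /class_sum big_seq_cond.
  by apply: sumr_le0 => t /andP[/noP]; rewrite negb_and -leNgt => /orP[/negP|].
have t0 := coprime_class_gt0 co_g tg.
have co_t : coprime t m by rewrite -coprime_modl tg coprime_modl.
have [_ /(_ t_gt0)[A [s [C [def_t AC]]]]] := divsum_gt0 t0 co_t.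
exists A, s, C; split=> //; first by rewrite -def_t.
by move: t0; rewrite def_t muln_gt0 => /andP[].
Qed.

End QuadraticCharacter.

(** * Three squares *)

(* Here [t = A * s ^ 2] lies in the class [3] mod [8] and [-1] mod [k]. *)
Lemma three_squares_data (k : nat) : odd k -> exists A B C s d : nat,
  [/\ 0 < A, A * C = B * B + 2 * k & A * s * s + 1 = 2 * k * d].
Proof.
move=> k_odd; have [chi [chiM chi_mod chi_sq chi_res chi_class]] := chi_exists k_odd.
have k_gt0 : 0 < k by case: k k_odd {chiM chi_mod chi_sq chi_res chi_class}.
have m_gt1 : 1 < 8 * k by lia.
have co8k : coprime 8 k by rewrite (@coprime_pexpl 3 2) // coprime2n.
pose g := chinese 8 k 3 k.-1.
have g8 : g %% 8 = 3 by rewrite chinese_modl.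
have kg : k %| g.+1.
  by rewrite /dvdn -addn1 -modnDml chinese_modr // modnDml addn1 prednK // modnn.
have chi_g := chi_class g g8 kg.
have co_g : coprime g (8 * k).
  by have := chi_sq g; rewrite chi_g; case: coprime.
have M_gt0 : 0 < 2 * k by rewrite muln_gt0.
have [A [s [B [As /dvdnP[C BC] A_gt0]]]] :=
  exists_in_class m_gt1 chiM chi_mod chi_sq chi_res M_gt0 co_g chi_g.
have /dvdnP[d dE] : 2 * k %| A * s ^ 2 + 1.
  rewrite /dvdn -modnDml -(modn_dvdm (A * s ^ 2) (_ : 2 * k %| 8 * k)); last first.
    by rewrite dvdn_pmul2r.
  rewrite As modn_dvdm ?dvdn_pmul2r // modnDml -/(dvdn _ _) Gauss_dvd ?coprime2n //.
  by rewrite addn1 kg andbT dvdn2 /=; lia.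
exists A, B, C, s, d; split=> //; first by rewrite mulnC -BC mulnn.
by rewrite -mulnA mulnn dE mulnC.
Qed.

Unset Implicit Arguments.
Open Scope Z_scope.

Lemma three_squares (k : Z) : 0 < k -> Z.odd k = true -> sum3sq (2 * k).
Proof.
intros Hk Hodd.
assert (Hn : ssrnat.odd (Z.to_nat k)).
{ rewrite <- (Z2Nat.id k) in Hodd by lia. revert Hodd. generalize (Z.to_nat k). intros n Hn.
  apply Z.odd_spec in Hn; destruct Hn as [j Hj]; lia. }
destruct (three_squares_data Hn) as (A & B & C & s & d & [HA HC Hd]).
assert (EC : Z.of_nat A * Z.of_nat C = Z.of_nat B * Z.of_nat B + 2 * k) by lia.
assert (Ed : Z.of_nat A * Z.of_nat s * Z.of_nat s + 1 = 2 * k * Z.of_nat d) by lia.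
assert (A_gt0 : 0 < Z.of_nat A) by lia.
clear HA HC Hd Hn; revert EC Ed A_gt0.
generalize (Z.of_nat A) (Z.of_nat B) (Z.of_nat C) (Z.of_nat s) (Z.of_nat d).
clear A B C s d; intros A B C s d EC Ed A_gt0.
(* Because [A s^2 = -1] mod [2 k], the vector [(A s, B s)] solves all three congruences; the third
   also uses [B^2 = A C - 2 k]. *)
apply (sum3sq_of_binary (2 * k) A B C (A * d) (B * d) (C * d - s * s) (A * s) (B * s)).
- lia.
- exact A_gt0.
- lia.
- transitivity (A * (A * s * s + 1)); [ring|rewrite Ed; ring].
- transitivity (B * (A * s * s + 1)); [ring|rewrite Ed; ring].
- transitivity (C * (A * s * s + 1) - (A * C - B * B) * (s * s)); [ring|].
  rewrite Ed EC; ring.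
Qed.

(** * The theorem *)

Lemma small_square (x : Z) : x ^ 2 = 0 \/ x ^ 2 = 1 \/ x ^ 2 = 4 \/ 9 <= x ^ 2.
Proof.
assert (x = -2 \/ x = -1 \/ x = 0 \/ x = 1 \/ x = 2 \/ x <= -3 \/ 3 <= x)
  as [-> | [-> | [-> | [-> | [-> | H]]]]] by lia; lia.
Qed.

Lemma loeschian_nonneg (z w : Z) : 0 <= z ^ 2 + z * w + w ^ 2.
Proof. nia. Qed.

(** Multiplying by 4 gives [(2 z + w)^2 + 3 w^2 = 8], and neither 8 nor 5 is a square. *)
Lemma loeschian_neq2 (z w : Z) : z ^ 2 + z * w + w ^ 2 <> 2.
Proof.
intros E.
assert (E2 : (2 * z + w) ^ 2 + 3 * w ^ 2 = 8) by lia.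
destruct (small_square w) as [H | [H | [H | H]]];
  destruct (small_square (2 * z + w)) as [G | [G | [G | G]]]; lia.
Qed.

(** Size alone gives [a = 1] from 1 and [b <= 2] from 2. If [b = 1], then [6 - 3 N] is a sum of two
    squares only for [N = 2], which [loeschian_neq2] excludes. *)
Lemma coefficients (a b : Z) : 0 < a -> a <= b ->
  represents a b 1 -> represents a b 2 -> represents a b 6 -> a = 1 /\ b = 2.
Proof.
assert (G : forall n, represents a b n -> exists X Y N,
  (X = 0 \/ X = 1 \/ X = 4 \/ 9 <= X) /\ (Y = 0 \/ Y = 1 \/ Y = 4 \/ 9 <= Y) /\
  0 <= N /\ N <> 2 /\ a * X + b * Y + 3 * N = n).
{ intros n (x & y & z & w & E); exists (x ^ 2), (y ^ 2), (z ^ 2 + z * w + w ^ 2).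
  auto 6 using small_square, loeschian_nonneg, loeschian_neq2. }
assert (P : forall c X, 0 < c -> X = 0 \/ X = 1 \/ X = 4 \/ 9 <= X -> X = 0 \/ c <= c * X).
{ intros c X Hc [H | [H | [H | H]]]; [left; exact H | right ..]; nia. }
intros Ha Hab H1 H2 H6.
destruct (G 1 H1) as (X1 & Y1 & N1 & SX1 & SY1 & HN1 & _ & E1).
assert (a = 1).
{ destruct (P a X1 Ha SX1) as [-> | Hx]; destruct (P b Y1 ltac:(lia) SY1) as [-> | Hy]; lia. }
subst a; clear X1 Y1 N1 SX1 SY1 HN1 E1.
destruct (G 2 H2) as (X2 & Y2 & N2 & SX2 & SY2 & HN2 & _ & E2).
assert (b <= 2).
{ destruct (P b Y2 ltac:(lia) SY2) as [-> | Hy]; lia. }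
destruct (G 6 H6) as (X6 & Y6 & N6 & SX6 & SY6 & HN6 & MN6 & E6).
clear X2 Y2 N2 SX2 SY2 HN2 E2.
assert (b <> 1); [intros -> | ]; lia.
Qed.

Theorem theorem5p4 (a b : Z) (ha : 0 < a) (hab : a <= b) :
  represents a b 1 -> represents a b 2 -> represents a b 6 ->
  forall n : Z, 0 <= n -> represents a b n.
Proof.
intros H1 H2 H6 n Hn.
destruct (coefficients a b ha hab H1 H2 H6) as [-> ->].
destruct (f123_universal three_squares n Hn) as (x & y & z & w & E).
exists x, y, z, w; unfold f3; lia.
Qed.
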